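(* Let $\mathbb{F}$ be a field of characteristic zero and let $(\mathcal{L},\mathcal{H})$ be an admissible Lie algebra over $\mathbb{F}$ with root system $R$. Suppose that $\mathcal{L}$ is simple and locally finite and that all the weight spaces $\mathcal{L}_\alpha$, $\alpha\in R$, are finite dimensional. Then $\mathcal{H}$ is a maximal toral subalgebra of $\mathcal{L}$.
   Context: A Lie algebra is locally finite if every finite subset generates a finite dimensional subalgebra. Toral subalgebra: a nonzero subalgebra $\mathcal{H}$ of a Lie algebra $\mathcal{L}$ such that $\mathcal{L}=\bigoplus_{\alpha\in\mathcal{H}^\star}\mathcal{L}_\alpha$ with $\mathcal{L}_\alpha=\{x\in\mathcal{L}\mid [h,x]=\alpha(h)x\ \forall h\in\mathcal{H}\}$, where $\mathcal{H}^\star$ is the dual space (that is, ''toral'' means split toral; such $\mathcal{H}$ is abelian). Maximal means maximal under inclusion among toral subalgebras. The root system of $\mathcal{L}$ with respect to $\mathcal{H}$ is $R=\{\alpha\in\mathcal{H}^\star\setminus\{0\}\mid\mathcal{L}_\alpha\ne\{0\}\}$; the spaces $\mathcal{L}_\alpha$, $\alpha\in R$, are called weight spaces. Admissible: $(\mathcal{L},\mathcal{H})$, with $\mathcal{H}$ a nonzero toral subalgebra of $\mathcal{L}$ and $R$ the root system, is admissible if $\mathcal{H}\subseteq\sum_{\alpha\in R}[\mathcal{L}_\alpha,\mathcal{L}_{-\alpha}]$ and for every $\alpha\in R$ and $0\neq x\in\mathcal{L}_\alpha$ there is $y\in\mathcal{L}_{-\alpha}$ such that $h:=[x,y]\in\mathcal{H}$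 and $(x,h,y)$ is an $\mathfrak{sl}_2$-triple, i.e. $[h,x]=2x$, $[h,y]=-2y$, $[x,y]=h$. *)

(* Defs.v *)
From HB Require Import structures.
From mathcomp Require Import all_boot all_order all_algebra.
From mathcomp Require Import boolp classical_sets functions cardinality fsbigop.

Set Implicit Arguments.
Unset Strict Implicit.
Unset Printing Implicit Defensive.

Import GRing.Theory.
Local Open Scope classical_set_scope.
Local Open Scope ring_scope.

HB.mixin Record Lmodule_isLieAlgebra (F : fieldType) L of GRing.Lmodule F L := {
  lie : L -> L -> L;
  lie_bilinear : bilinear_for *:%R *:%R lie;
  liexx : forall x, lie x x = 0;
  lie_jacobi : forall x y z,
    lie x (lie y z) + lie y (lie z x) + lie z (lie x y) = 0
}.

#[short(type="lieAlgType")]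
HB.structure Definition LieAlgebra (F : fieldType) :=
  {L of GRing.Lmodule F L & Lmodule_isLieAlgebra F L}.

Section LinearAlgebra.
Variables (F : fieldType) (V : lmodType F).
Implicit Types A B W : set V.

Definition is_subspace W := submod_closed [in W].

Definition lspan A : set V := smallest is_subspace A.

Definition fin_dim W := exists B, finite_set B /\ lspan B = W.

(* V is the internal direct sum of the W i, i in D: every vector has a unique
   decomposition along a finitely supported family. The condition off D only
   makes the family, a function on the whole of I, unique. Finiteness of the
   support is needed because \sum_(i \in D) is 0 on infinite supports. *)
Definition is_direct_sum (I : choiceType) (D : set I) (W : I -> set V) :=
  forall x : V, exists! u : I -> V,
    [/\ forall i, D i -> W i (u i),
        forall i, ~ D i -> u i = 0,
        finite_set [set i | u i <> 0]
      & \sum_(i \in D) u i = x].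

(* Linear forms on W, as functions on the type of elements of W. Since that type
   carries no module structure, linearity is stated through \val. *)
Definition dual_space W : set (W -> F) :=
  [set f | forall (a : F) (u v w : W),
     \val w = a *: \val u + \val v -> f w = a * f u + f v].

End LinearAlgebra.

Section LieAlgebra.
Variables (F : fieldType) (L : lieAlgType F).
Implicit Types A B H I : set L.

(* [A, B], the subspace spanned by the brackets *)
Definition lie_prod A B : set L :=
  lspan [set z | exists x y, [/\ A x, B y & z = lie x y]].

Definition lie_subalgebra A :=
  is_subspace A /\ (forall x y, A x -> A y -> A (lie x y)).

Definition lie_ideal I :=
  is_subspace I /\ (forall x y, I y -> I (lie x y)).

Definition lie_generated A : set L := smallest lie_subalgebra A.

Definition lie_simple :=
  ~ (forall x y : L, lie x y = 0) /\
  (forall I, lie_ideal I -> I = [set 0] \/ I = setT).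

Definition locally_finite :=
  forall A, finite_set A -> fin_dim (lie_generated A).

Definition weight_space H (alpha : H -> F) : set L :=
  [set x | forall h : H, lie (\val h) x = alpha h *: x].

Definition toral H :=
  [/\ lie_subalgebra H, H <> [set 0]
    & is_direct_sum (@dual_space F L H) (@weight_space H)].

Definition maximal_toral H :=
  toral H /\ (forall H', toral H' -> H `<=` H' -> H' = H).

Definition root_system H : set (H -> F) :=
  [set alpha | [/\ dual_space alpha, alpha <> 0
                & weight_space alpha <> [set 0]]].
Arguments root_system : clear implicits.

Definition sl2_triple (x h y : L) :=
  [/\ lie h x = 2 *: x, lie h y = (- 2) *: y & lie x y = h].

Definition admissible H :=
  [/\ toral H,
      H `<=` lspan (\bigcup_(alpha in root_system H)
                      lie_prod (weight_space alpha) (weight_space (- alpha)))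
    & forall alpha, root_system H alpha ->
      forall x, weight_space alpha x -> x <> 0 ->
      exists y, [/\ weight_space (- alpha) y, H (lie x y)
                  & sl2_triple x (lie x y) y]].

End LieAlgebra.

Arguments root_system {F L} H _.
Arguments lie_simple {F} L.
Arguments locally_finite {F} L.

(* Main.v *)
From HB Require Import structures.
Require Import Defs.
From mathcomp Require Import all_boot all_order all_algebra.
From mathcomp Require Import boolp classical_sets functions cardinality fsbigop.
From mathcomp Require Import finmap ring.

Set Implicit Arguments.
Unset Strict Implicit.
Unset Printing Implicit Defensive.

Import GRing.Theory.
Local Open Scope classical_set_scope.
Local Open Scope ring_scope.

(**
  Let T be a toral subalgebra containing H, and t in T; the claim is t \in H.

  Since L is simple its center is 0, so T is abelian and refines the weight
  decomposition of H. Call (x, y) a coroot pair when x and y have opposite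
  T-weights alpha and -alpha and (x, [x, y], y) is an sl2-triple with [x, y]
  in H. Admissibility provides such a y for every T-weight vector x that does
  not commute with H: the partner given for H may be replaced by its component
  of T-weight -alpha, because [x, y] has T-weight 0 (coroot_pair_exists). The
  subalgebra generated by these x is an ideal, hence is L
  (coroot_pairs_generate). So t lies in a subalgebra g generated by finitely
  many coroot pairs (x_i, y_i), and g is finite dimensional. Put
  h_i = [x_i, y_i].

  Two facts about g finish the proof.

  - An element c of T and g that commutes with g is 0 (toral_center_eq0).
    Otherwise ad c has an eigenvalue mu <> 0 on some T-weight vector v. The
    mu-eigenspace of ad c in the finite dimensional algebra generated by g and
    v is g-stable; the generators of g are multiples of commutators, so every
    element of g has trace 0 on it, whereas c has trace mu times its dimension.

  - For the trace form B of the adjoint action of g on itself,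
    B(h_i, u) = alpha_i(u) B(x_i, y_i) when u is in T and g, and B(h_i, h_i) is
    a nonzero sum of squares of integers by sl2-theory. Hence an element u of T
    and g that is B-orthogonal to all h_i commutes with all x_i and y_i, and so
    vanishes by the first fact.

  Orthogonality implying vanishing, applied to linear combinations of the h_i,
  shows that the linear system B(h_i, sum_j c_j h_j) = B(h_i, t) is solvable;
  applied to t - sum_j c_j h_j it gives t = sum_j c_j h_j, which is in H.
*)

(** * Linear combinations and bases of subspaces *)

Section LinearAlgebra.
Variables (F : fieldType) (V : lmodType F).
Implicit Types W S : set V.

Lemma is_subspaceP W :
  is_subspace W <-> W 0 /\ (forall a u v, W u -> W v -> W (a *: u + v)).
Proof.
have inW (x : V) : (x \in [in W]) <-> W x by split=> [/set_mem|/mem_set].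
split=> [[/inW W0 WD]|[W0 WD]].
  by split=> // a u v /inW Wu /inW Wv; apply/inW; apply: WD.
by split=> [|a u v /inW Wu /inW Wv]; apply/inW => //; apply: WD.
Qed.

Lemma subspace0 W : is_subspace W -> W 0.
Proof. by case/is_subspaceP. Qed.

Lemma subspaceZD W a u v : is_subspace W -> W u -> W v -> W (a *: u + v).
Proof. by case/is_subspaceP=> _; apply. Qed.

Lemma subspaceD W u v : is_subspace W -> W u -> W v -> W (u + v).
Proof. by move=> sW Wu Wv; rewrite -[u]scale1r; apply: subspaceZD. Qed.

Lemma subspaceZ W a u : is_subspace W -> W u -> W (a *: u).
Proof.
by move=> sW Wu; rewrite -[_ *: _]addr0; apply: subspaceZD; last exact: subspace0.
Qed.

Lemma subspaceB W u v : is_subspace W -> W u -> W v -> W (u - v).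
Proof.
by move=> sW Wu Wv; rewrite -scaleN1r; apply: subspaceD => //; apply: subspaceZ.
Qed.

Lemma subspace_sum W (I : Type) (r : seq I) (P : pred I) (u : I -> V) :
  is_subspace W -> (forall i, P i -> W (u i)) -> W (\sum_(i <- r | P i) u i).
Proof.
move=> sW Wu; apply: big_ind => //; first exact: subspace0.
by move=> x y; apply: subspaceD.
Qed.

Lemma subspace_lspan S : is_subspace (lspan S).
Proof.
apply/is_subspaceP; split=> [W [sW _]|a u v Su Sv W [sW SW]].
  exact: subspace0.
by apply: subspaceZD => //; [apply: Su | apply: Sv].
Qed.

Definition lincomb n (e : 'I_n -> V) (c : 'rV[F]_n) := \sum_i c 0 i *: e i.

Definition spanned n (e : 'I_n -> V) : set V := range (lincomb e).

Definition lin_free n (e : 'I_n -> V) := forall c, lincomb e c = 0 -> c = 0.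

Fact lincomb_is_linear n (e : 'I_n -> V) : linear (lincomb e).
Proof.
move=> a c d; rewrite /lincomb scaler_sumr -big_split /=.
by apply: eq_bigr => i _; rewrite !mxE scalerDl scalerA.
Qed.

HB.instance Definition _ n (e : 'I_n -> V) :=
  GRing.isLinear.Build F 'rV[F]_n V *:%R (lincomb e) (lincomb_is_linear e).

Lemma lincomb_delta n (e : 'I_n -> V) i : lincomb e (delta_mx 0 i) = e i.
Proof.
rewrite /lincomb (bigD1 i) //= mxE !eqxx scale1r big1 ?addr0 // => j ji.
by rewrite mxE (negPf ji) scale0r.
Qed.

Lemma subspace_spanned n (e : 'I_n -> V) : is_subspace (spanned e).
Proof.
apply/is_subspaceP; split=> [|a _ _ [c _ <-] [d _ <-]].
  by exists 0; rewrite ?linear0.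
by exists (a *: c + d); rewrite ?linearP.
Qed.

Lemma spanned_gen n (e : 'I_n -> V) i : spanned e (e i).
Proof. by exists (delta_mx 0 i); rewrite ?lincomb_delta. Qed.

Lemma lincomb_inj n (e : 'I_n -> V) : lin_free e -> injective (lincomb e).
Proof.
move=> fe c d ecd; apply/eqP; rewrite -subr_eq0; apply/eqP/fe.
by rewrite linearB /= ecd subrr.
Qed.

Lemma lincomb_mulmx m n (e : 'I_m -> V) (b : 'I_n -> V) (C : 'M_(m, n)) r :
  (forall i, e i = lincomb b (row i C)) -> lincomb e r = lincomb b (r *m C).
Proof.
move=> eC; rewrite /lincomb.
under eq_bigr => i _ do rewrite eC /lincomb scaler_sumr.
rewrite exchange_big /=; apply: eq_bigr => j _.
rewrite mxE scaler_suml; apply: eq_bigr => i _.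
by rewrite mxE scalerA.
Qed.

(** The coordinates of e on b form a matrix with trivial left kernel, whose
    rank is therefore its height. *)
Lemma lin_free_leq m n (e : 'I_m -> V) (b : 'I_n -> V) :
  (forall i, spanned b (e i)) -> lin_free e -> (m <= n)%N.
Proof.
move=> eb fe.
have /boolp.choice[c ec] i : exists c, e i = lincomb b c.
  by have [c _ <-] := eb i; exists c.
pose C := \matrix_i c i.
suff /eqP <- : row_free C by apply: rank_leq_col.
rewrite -kermx_eq0; apply/eqP/row_matrixP => i; rewrite row0.
apply: fe; rewrite (@lincomb_mulmx _ _ _ b C) => [|j]; last by rewrite rowK.
by rewrite -row_mul mulmx_ker row0 linear0.
Qed.

Lemma fin_dim_spanned W :
  fin_dim W -> exists n (b : 'I_n -> V), W `<=` spanned b.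
Proof.
case=> B [/finite_seqP[s ->] <-].
exists (size s), (fun i => tnth (in_tuple s) i).
apply: smallest_sub; first exact: subspace_spanned.
move=> v /= /(tnthP (in_tuple s))[i ->].
exact: (spanned_gen (fun i => tnth (in_tuple s) i)).
Qed.

(** Take a free family of maximal size among those drawn from S; sizes are
    bounded because W is finite dimensional. Choosing the basis inside S is what
    later provides bases of eigenvectors. *)
Lemma basis_exists W S : fin_dim W -> S `<=` W ->
  exists n (e : 'I_n -> V),
    [/\ lin_free e, forall i, S (e i) & lspan S `<=` spanned e].
Proof.
move=> /fin_dim_spanned[N [b Wb]] SW.
pose P n := `[< exists e : 'I_n -> V, lin_free e /\ forall i, S (e i) >].
have exP : exists n, P n.
  exists 0; apply/asboolP; exists (fun=> 0); split=> [c _|[]//].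
  by apply/rowP => -[].
have ubP n : P n -> (n <= N)%N.
  move/asboolP=> [e [fe Se]]; apply: (lin_free_leq (b := b)) fe => i.
  exact/Wb/SW.
case: (ex_maxnP exP ubP) => n /asboolP[e [fe Se]] maxn.
exists n, e; split=> //; apply: smallest_sub; first exact: subspace_spanned.
move=> s Ss; apply: contrapT => nes.
pose e' (i : 'I_(1 + n)) := match fintype.split i with inl _ => s | inr j => e j end.
suff /maxn : P (1 + n)%N by rewrite ltnn.
apply/asboolP; exists e'; split=> [c|i]; last first.
  by rewrite /e'; case: (fintype.split i).
have -> : lincomb e' c =
    c 0 (lshift n ord0) *: s + lincomb e (\row_i c 0 (rshift 1 i)).
  rewrite /lincomb big_split_ord big_ord1 /e'; congr (_ + _).
    by rewrite (unsplitK (inl ord0)).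
  by apply: eq_bigr => i _; rewrite (unsplitK (inr i)) mxE.
set a := c 0 _; set d := \row_i _ => acd.
have a0 : a = 0.
  apply/eqP/negPn/negP => a0; apply: nes; exists (- a^-1 *: d) => //.
  rewrite linearZ /=.
  move/eqP: acd; rewrite addrC addr_eq0 => /eqP ->.
  by rewrite scalerN scaleNr opprK scalerA mulVf // scale1r.
have d0 : d = 0 by apply: fe; rewrite -acd a0 scale0r add0r.
apply/rowP => i; rewrite mxE -(splitK (i : 'I_(1 + n))); case: (fintype.split i) => j /=.
  by rewrite [j]ord1.
by move/rowP: d0 => /(_ j); rewrite !mxE.
Qed.

Lemma eigen_lin_free (f : {linear V -> V}) (v : nat -> V) (mu : nat -> F) n :
  injective mu -> (forall k, v k != 0) -> (forall k, f (v k) = mu k *: v k) ->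
  lin_free (fun i : 'I_n => v i).
Proof.
move=> muI v0 fv c c0; apply/rowP => i; rewrite mxE.
(* Coefficients are extended to all of nat so that the induction on the
   number of terms needs no change of ordinal type. *)
suff H : forall m (d : nat -> F), \sum_(k < m) d k *: v k = 0 ->
    forall k, (k < m)%N -> d k = 0.
  pose d k := if insub k is Some i then c 0 i else 0.
  have dE (j : 'I_n) : d j = c 0 j by rewrite /d valK.
  rewrite -dE; apply: (H n) => //.
  by rewrite -[RHS]c0; apply: eq_bigr => j _; rewrite dE.
elim=> // m IH d dv k.
(* Applying f - mu m kills the last term and leaves a shorter relation. *)
have d0 j : (j < m)%N -> d j = 0.
  move=> jm; have := IH (fun j => d j * (mu j - mu m)) _ j jm => /(_ _)/eqP.
  rewrite mulf_eq0 subr_eq0 (inj_eq muI) (ltn_eqF jm) orbF => /(_ _)/eqP -> //.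
  have: f (\sum_(k < m.+1) d k *: v k) - mu m *: (\sum_(k < m.+1) d k *: v k) = 0.
    by rewrite dv linear0 scaler0 subr0.
  rewrite linear_sum scaler_sumr -sumrB big_ord_recr /=.
  rewrite linearZ /= fv !scalerA [mu m * _]mulrC subrr addr0 => dv0; rewrite -[RHS]dv0.
  apply: eq_bigr => l _; rewrite linearZ /= fv !scalerA -scalerBl.
  by rewrite mulrBr [mu m * _]mulrC.
rewrite ltnS leq_eqVlt => /orP[/eqP ->|]; last exact: d0.
move: dv; rewrite big_ord_recr big1 /= ?add0r => [|i' _]; last by rewrite d0 ?scale0r.
by move/eqP; rewrite scaler_eq0 (negPf (v0 m)) orbF => /eqP.
Qed.

End LinearAlgebra.

(** * Lie algebras and generated subalgebras *)

Section LieBasics.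
Variables (F : fieldType) (L : lieAlgType F).
Implicit Types (c x y z : L) (A W : set L).

Fact lie_is_linear x : linear (lie x).
Proof. by move=> a u v; rewrite (lie_bilinear.2 x). Qed.

HB.instance Definition _ x :=
  GRing.isLinear.Build F L L *:%R (lie x) (lie_is_linear x).

Lemma lieZDl a x y z : lie (a *: x + y) z = a *: lie x z + lie y z.
Proof. exact: (lie_bilinear.1 z). Qed.

Lemma lieC x y : lie x y = - lie y x.
Proof.
apply/eqP; rewrite -addr_eq0; apply/eqP.
have := liexx (x + y); rewrite -{1}[x]scale1r lieZDl scale1r !linearD /=.
by rewrite !liexx add0r addr0.
Qed.

Lemma lieZl a x y : lie (a *: x) y = a *: lie x y.
Proof. by rewrite -[a *: x]addr0 lieZDl [lie 0 y]lieC linear0 oppr0 addr0. Qed.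

Lemma lie_lie x y z : lie (lie x y) z = lie x (lie y z) - lie y (lie x z).
Proof.
rewrite lieC; apply/eqP; rewrite eq_sym -addr_eq0.
by rewrite [lie x z]lieC linearN opprK lie_jacobi.
Qed.

Lemma lie_der x y z : lie x (lie y z) = lie (lie x y) z + lie y (lie x z).
Proof. by rewrite lie_lie subrK. Qed.

Lemma lie_generated_subalgebra A : lie_subalgebra (lie_generated A).
Proof.
split=> [|x y Ax Ay W sW].
  apply/is_subspaceP; split=> [W [[sW _] _]|a u v Au Av W sW].
    exact: subspace0.
  by apply: subspaceZD; [case: sW => -[]|exact: Au|exact: Av].
by case: (sW) => -[_ WM] _; apply: WM; [exact: Ax|exact: Ay].
Qed.

Lemma sub_lie_generated A : A `<=` lie_generated A.
Proof. exact: sub_gen_smallest. Qed.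

Lemma lie_generated_min A W :
  lie_subalgebra W -> A `<=` W -> lie_generated A `<=` W.
Proof. exact: smallest_sub. Qed.

Lemma lie_generatedS A W : A `<=` W -> lie_generated A `<=` lie_generated W.
Proof.
move=> AW; apply: lie_generated_min; first exact: lie_generated_subalgebra.
by apply: subset_trans AW _; apply: sub_lie_generated.
Qed.

Lemma commutant_subalgebra c : lie_subalgebra [set z | lie c z = 0].
Proof.
split=> [|x y /= cx cy]; last by rewrite lie_der cx cy linear0 addr0 lieC linear0 oppr0.
apply/is_subspaceP; split=> [|a u v /= cu cv]; first by rewrite /= linear0.
by rewrite linearP /= cu cv scaler0 addr0.
Qed.

Lemma stabilizer_subalgebra W : is_subspace W ->
  lie_subalgebra [set z | forall w, W w -> W (lie z w)].
Proof.
move=> sW; split=> [|x y /= Wx Wy w Ww].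
  apply/is_subspaceP; split=> [w Ww|a u v /= Wu Wv w Ww].
    by rewrite lieC linear0 oppr0; apply: subspace0.
  by rewrite lieZDl; apply: subspaceZD; [|apply: Wu|apply: Wv].
by rewrite lie_lie; apply: subspaceB; [|apply/Wx/Wy|apply/Wy/Wx].
Qed.

Lemma center_eq0 c : @lie_simple F L -> (forall z, lie c z = 0) -> c = 0.
Proof.
move=> [nonab simp] cc.
pose Z : set L := [set z | forall y, lie z y = 0].
have iZ : lie_ideal Z.
  split=> [|x y yZ z]; last by rewrite lie_lie !yZ linear0 subr0.
  apply/is_subspaceP; split=> [y|a u v Zu Zv y].
    by rewrite lieC linear0 oppr0.
  by rewrite lieZDl Zu Zv scaler0 addr0.
case: (simp _ iZ) => ZE; first by have : Z c by []; rewrite ZE.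
by case: nonab => x; have : Z x by rewrite ZE.
Qed.

End LieBasics.

Lemma lspan_subalgebra (F : fieldType) (L : lieAlgType F) (S : set L) :
  (forall x y, S x -> S y -> S (lie x y)) -> lie_subalgebra (lspan S).
Proof.
move=> SM; have sS := subspace_lspan S; split=> // x y Sx; move: y.
have sub0 (P : set L) : is_subspace P -> S `<=` P -> lspan S `<=` P.
  exact: smallest_sub.
have SU : S `<=` lspan S by apply: sub_gen_smallest.
apply: (sub0 [set y | lspan S (lie x y)]) => [|y Sy].
  apply/is_subspaceP; split=> [|a u v /= xu xv].
    by rewrite /= linear0; exact: (subspace0 sS).
  by rewrite linearP; exact: (subspaceZD _ sS).
move: x Sx; apply: (sub0 [set x | lspan S (lie x y)]) => [|x Sx]; last first.
  exact: (SU _ (SM _ _ Sx Sy)).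
apply/is_subspaceP; split=> [|a u v uy vy] /=.
  by rewrite lieC linear0 oppr0; exact: (subspace0 sS).
by rewrite lieZDl; exact: (subspaceZD _ sS).
Qed.

(** * The adjoint action on a finite dimensional subspace *)

Section AdjointMatrix.
Variables (F : fieldType) (L : lieAlgType F) (n : nat) (e : 'I_n -> L).

Definition ad_stable a := forall i, spanned e (lie a (e i)).

(** Row i holds the coordinates of [a, e i], so that matrices act on row vectors
    of coordinates from the right and products appear in reverse order. The
    value is meaningful only when a is ad_stable. *)
Definition ad_mx (a : L) : 'M[F]_n :=
  \matrix_i xget 0 [set c | lincomb e c = lie a (e i)].

Lemma ad_mx_row a i : ad_stable a -> lincomb e (row i (ad_mx a)) = lie a (e i).
Proof. by move=> /(_ i)[c _ ec]; rewrite rowK; case: xgetP => //= /(_ c). Qed.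

Lemma lie_lincomb a c :
  ad_stable a -> lie a (lincomb e c) = lincomb e (c *m ad_mx a).
Proof.
move=> sa; rewrite -(lincomb_mulmx (e := fun i => lie a (e i))) => [|i].
  by rewrite /lincomb linear_sum; apply: eq_bigr => i _; rewrite linearZ.
by rewrite ad_mx_row.
Qed.

Lemma spanned_lie a v : ad_stable a -> spanned e v -> spanned e (lie a v).
Proof. by move=> sa [c _ <-]; rewrite lie_lincomb //; exists (c *m ad_mx a). Qed.

Hypothesis fe : lin_free e.

Lemma ad_mxE a (A : 'M_n) :
  (forall i, lie a (e i) = lincomb e (row i A)) -> ad_mx a = A.
Proof.
move=> eA; apply/row_matrixP => i; apply: (lincomb_inj fe).
by rewrite ad_mx_row -?eA // => j; exists (row j A); rewrite ?eA.
Qed.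

Lemma ad_mxZD k a b : ad_stable a -> ad_stable b ->
  ad_mx (k *: a + b) = k *: ad_mx a + ad_mx b.
Proof.
move=> sa sb; apply: ad_mxE => i.
by rewrite !linearP /= !ad_mx_row ?lieZDl.
Qed.

Lemma ad_mx0 : ad_mx 0 = 0.
Proof. by apply: ad_mxE => i; rewrite lieC !linear0. Qed.

Lemma ad_mxZ k a : ad_stable a -> ad_mx (k *: a) = k *: ad_mx a.
Proof. by move=> sa; apply: ad_mxE => i; rewrite !linearZ /= ad_mx_row // lieZl. Qed.

Lemma ad_mxB a b : ad_stable a -> ad_stable b -> ad_mx (a - b) = ad_mx a - ad_mx b.
Proof. by move=> sa sb; rewrite addrC -scaleN1r ad_mxZD // scaleN1r addrC. Qed.

Lemma ad_mx_lie a b : ad_stable a -> ad_stable b ->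
  ad_mx (lie a b) = ad_mx b *m ad_mx a - ad_mx a *m ad_mx b.
Proof.
move=> sa sb; apply: ad_mxE => i.
by rewrite !linearB /= !row_mul -!lie_lincomb // !ad_mx_row // lie_lie.
Qed.

Lemma trace_lie a b : ad_stable a -> ad_stable b -> \tr (ad_mx (lie a b)) = 0.
Proof. by move=> sa sb; rewrite ad_mx_lie // raddfB /= mxtrace_mulC subrr. Qed.

Definition trace_form a b := \tr (ad_mx a *m ad_mx b).

Lemma trace_formC a b : trace_form a b = trace_form b a.
Proof. exact: mxtrace_mulC. Qed.

Lemma trace_form_lie x y t : ad_stable x -> ad_stable y -> ad_stable t ->
  trace_form (lie x y) t = trace_form x (lie y t).
Proof.
move=> sx sy st; rewrite /trace_form !ad_mx_lie // mulmxBl mulmxBr !raddfB /=.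
by rewrite addrC [in LHS]addrC -!mulmxA; congr (_ - _); rewrite mxtrace_mulC mulmxA.
Qed.

(** Commutators have trace 0, so the elements of trace 0 form a subalgebra. *)
Lemma trace_generated A :
    (forall a, lie_generated A a -> ad_stable a) ->
    (forall a, A a -> \tr (ad_mx a) = 0) ->
  forall a, lie_generated A a -> \tr (ad_mx a) = 0.
Proof.
move=> sA trA a Aa; have [gS gM] := lie_generated_subalgebra A.
suff : [set a | lie_generated A a /\ \tr (ad_mx a) = 0] a by case.
move: a Aa; apply: lie_generated_min => [|a Aa]; last first.
  by split; [apply: sub_lie_generated | apply: trA].
split=> [|x y [Ax _] [Ay _]]; last first.
  by split; [apply: gM | apply: trace_lie; apply: sA].
apply/is_subspaceP; split=> [|k u v [Au tu] [Av tv]].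
  by split; [exact: (subspace0 gS) | rewrite ad_mx0 mxtrace0].
split; first exact: (subspaceZD _ gS).
by rewrite ad_mxZD ?mxtraceD ?mxtraceZ ?tu ?tv ?mulr0 ?addr0 //; apply: sA.
Qed.

End AdjointMatrix.

Lemma ad_mx_lincomb (F : fieldType) (L : lieAlgType F) n (e : 'I_n -> L) m
    (h : 'I_m -> L) c : lin_free e -> (forall j, ad_stable e (h j)) ->
  ad_mx e (lincomb h c) = \sum_j c 0 j *: ad_mx e (h j).
Proof.
move=> fe sh; apply: ad_mxE => // i.
rewrite lieC [lincomb h c]/lincomb linear_sum -sumrN.
rewrite [row i _]linear_sum linear_sum; apply: eq_bigr => j _.
by rewrite !linearZ /= ad_mx_row // -lieC.
Qed.

(** * Finite dimensional representations of sl2 *)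

Section Sl2.
Variables (F : fieldType) (charF0 : [pchar F] =i pred0) (L : lieAlgType F).

Fact natr_inj_pchar0 : injective (fun k : nat => k%:R : F).
Proof.
have natr0 := (pcharf0P F).1 charF0.
move=> i j /=; wlog le_ij : i j / (i <= j)%N => [W|/esym/eqP].
  by case: (leqP i j) => [/W//|/ltnW/W Wji /esym/Wji].
rewrite -subr_eq0 -natrB // natr0 subn_eq0 => le_ji.
by apply/eqP; rewrite eqn_leq le_ij.
Qed.

Variables (n : nat) (e : 'I_n -> L) (x y : L).
Let h := lie x y.
Hypotheses (sl2 : sl2_triple x h y) (sx : ad_stable e x) (sy : ad_stable e y).

(** Eigenvectors for distinct eigenvalues are free, hence infinitely many cannot
    all be nonzero in a finite dimensional space. *)
Lemma weight_seq_vanish (v : nat -> L) (mu : nat -> F) : injective mu ->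
    (forall k, spanned e (v k)) -> (forall k, lie h (v k) = mu k *: v k) ->
  exists k, v k = 0.
Proof.
move=> muI ev hv; apply: contrapT => nv0.
have fv : lin_free (fun i : 'I_n.+1 => v i).
  apply: (eigen_lin_free (f := lie h) muI _ hv) => k.
  by apply/eqP => vk; apply: nv0; exists k.
by have := lin_free_leq (fun i : 'I_n.+1 => ev i) fv; rewrite ltnn.
Qed.

Lemma sl2_raise mu v : lie h v = mu *: v -> lie h (lie x v) = (mu + 2) *: lie x v.
Proof.
case: sl2 => hx _ _ hv.
by rewrite lie_der hx hv linearZ /= lieC linearZ /= -scalerN -lieC -scalerDl addrC.
Qed.

Lemma sl2_lower mu v : lie h v = mu *: v -> lie h (lie y v) = (mu - 2) *: lie y v.
Proof.
case: sl2 => _ hy _ hv.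
by rewrite lie_der hy hv linearZ /= lieC linearZ /= -scalerN -lieC -scalerDl addrC.
Qed.

(** Raising with x adds 2 to the weight at each step, so it must reach 0; the
    last nonzero vector is primitive. *)
Lemma exists_primitive mu v : spanned e v -> v != 0 -> lie h v = mu *: v ->
  exists k w, [/\ spanned e w, w != 0, lie h w = (mu + (2 * k)%:R) *: w & lie x w = 0].
Proof.
move=> ev v0 hv; pose u k := iter k (lie x) v.
have eu k : spanned e (u k) by elim: k => //= k; apply: spanned_lie.
have hu k : lie h (u k) = (mu + (2 * k)%:R) *: u k.
  elim: k => [|k IH] /=; first by rewrite muln0 addr0.
  by rewrite (sl2_raise IH) -addrA -natrD mulnS (addnC 2).
have muI : injective (fun k => mu + (2 * k)%:R).
  by move=> i j /addrI/natr_inj_pchar0/eqP; rewrite eqn_pmul2l // => /eqP.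
have exk : exists k, u k == 0.
  by have [k uk] := weight_seq_vanish muI eu hu; exists k; apply/eqP.
case: (ex_minnP exk) => -[|k] uk mink; first by rewrite (negPf v0) in uk.
exists k, (u k); split=> //; last exact/eqP.
by apply/negP => /mink; rewrite ltnn.
Qed.

(** For a primitive vector w of weight nu, [x, y^(k+1) w] equals
    (k+1)(nu - k) y^k w; where the lowering sequence dies this forces nu = k. *)
Lemma primitive_weight_nat nu w : spanned e w -> w != 0 ->
  lie h w = nu *: w -> lie x w = 0 -> exists m, nu = m%:R.
Proof.
move=> ew w0 hw xw; pose u k := iter k (lie y) w.
have eu k : spanned e (u k) by elim: k => //= k; apply: spanned_lie.
have hu k : lie h (u k) = (nu - (2 * k)%:R) *: u k.
  elim: k => [|k IH] /=; first by rewrite muln0 subr0.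
  by rewrite (sl2_lower IH) -addrA -opprD -natrD mulnS (addnC 2).
have xu k : lie x (u k.+1) = (k.+1%:R * (nu - k%:R)) *: u k.
  elim: k => [|k IH].
    by rewrite /= lie_der -/h hw xw linear0 addr0 mul1r subr0.
  rewrite -/(u k.+2) [u k.+2]/(lie y (u k.+1)) lie_der -/h hu IH.
  rewrite linearZ /= -scalerDl; congr (_ *: _).
  ring.
have muI : injective (fun k => nu - (2 * k)%:R).
  by move=> i j /addrI/oppr_inj/natr_inj_pchar0/eqP; rewrite eqn_pmul2l // => /eqP.
have exk : exists k, u k == 0.
  by have [k uk] := weight_seq_vanish muI eu hu; exists k; apply/eqP.
case: (ex_minnP exk) => -[|k] /eqP uk mink; first by rewrite -uk eqxx in w0.
have uk0 : u k != 0 by apply/negP => /mink; rewrite ltnn.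
exists k; move/eqP: (xu k); rewrite uk linear0 eq_sym scaler_eq0 (negPf uk0).
rewrite orbF mulf_eq0 subr_eq0 => /orP[|/eqP //].
by rewrite ((pcharf0P F).1 charF0).
Qed.

Lemma sl2_weight_int mu v : spanned e v -> v != 0 -> lie h v = mu *: v ->
  exists m : nat, mu = m%:R \/ mu = - m%:R.
Proof.
move=> ev v0 hv; have [k [w [ew w0 hw xw]]] := exists_primitive ev v0 hv.
have [m /eqP] := primitive_weight_nat ew w0 hw xw.
rewrite eq_sym -subr_eq eq_sym => /eqP ->.
case: (leqP (2 * k) m) => [|/ltnW] le_km.
  by exists (m - 2 * k)%N; left; rewrite natrB.
by exists (2 * k - m)%N; right; rewrite natrB // opprB.
Qed.

(** In a basis of eigenvectors the form is the sum of the squares of the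
    weights, which are integers; as the characteristic is 0 it vanishes only
    when h acts as 0, which [h, x] = 2 x excludes. *)
Lemma trace_form_coroot_neq0 : lin_free e -> spanned e x -> x != 0 ->
  (forall i, exists mu, lie h (e i) = mu *: e i) -> trace_form e h h != 0.
Proof.
move=> fe ex x0 /boolp.choice[mu hmu].
have natr0 := (pcharf0P F).1 charF0.
have e0 i : e i != 0.
  apply/eqP => ei; have := fe (delta_mx 0 i); rewrite lincomb_delta => /(_ ei).
  by move/rowP/(_ i)/eqP; rewrite !mxE !eqxx oner_eq0.
have /boolp.choice[m mE] i : exists m : nat, mu i = m%:R \/ mu i = - m%:R.
  exact: (sl2_weight_int (spanned_gen e i) (e0 i) (hmu i)).
have hE : ad_mx e h = diag_mx (\row_i mu i).
  apply: ad_mxE => // i; rewrite row_diag_mx mxE linearZ /= lincomb_delta.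
  exact: hmu.
rewrite /trace_form hE mulmx_diag mxtrace_diag.
have -> : \sum_i (\row_j ((\row_i mu i) 0 j * (\row_i mu i) 0 j)) 0 i
          = (\sum_i m i ^ 2)%N%:R.
  rewrite natr_sum; apply: eq_bigr => i _; rewrite !mxE natrX expr2.
  by case: (mE i) => ->; rewrite ?mulrNN.
rewrite natr0 sum_nat_eq0; apply/negP => /forallP m0.
have h0 : ad_mx e h = 0.
  apply/matrixP => i j; rewrite hE !mxE; case: eqP => // _.
  have /eqP mi : m i == 0%N by have := m0 i; rewrite expn_eq0 andbT.
  by case: (mE i) => ->;
    rewrite mi ?oppr0.
have sh : ad_stable e h.
  by move=> i; exists (mu i *: delta_mx 0 i); rewrite // linearZ /= lincomb_delta hmu.
case: sl2 => hx _ _; case: ex hx x0 => c _ <-.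
rewrite lie_lincomb // h0 mulmx0 linear0 => /esym/eqP.
by rewrite scaler_eq0 natr0 /= => ->.
Qed.

End Sl2.

(** * Internal direct sums and weight decompositions *)

Section DirectSum.
Variables (F : fieldType) (V : lmodType F) (I : choiceType).
Variables (D : set I) (W : I -> set V).

Lemma fsum_fset (u : I -> V) (X : {fset I}) : (forall i, ~ D i -> u i = 0) ->
    [set i | u i <> 0] `<=` [set` X] ->
  \sum_(i \in D) u i = \sum_(i <- X) u i.
Proof.
move=> uD uX; rewrite fsbig_mkcond /=.
rewrite (_ : patch _ _ _ = u); last first.
  apply/funext => i; rewrite /patch; case: ifPn => // /negP iD.
  by rewrite uD // => /mem_set.
apply: fsbigTE => i iX; apply: contrapT => ui.
by move: (uX i ui) => /= iX'; rewrite iX' in iX.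
Qed.

Hypothesis dsum : is_direct_sum D W.

Lemma direct_sum_ind (P : set V) : is_subspace P ->
  (forall i v, D i -> W i v -> P v) -> forall v, P v.
Proof.
move=> sP WP v; have [u [[Wu uD fu <-] _]] := dsum v.
rewrite (fsum_fset (X := fset_set [set i | u i <> 0])) // ?fset_setK //.
apply: subspace_sum => // i _; case: (pselect (D i)) => [Di|/uD ->].
  by apply: WP (Wu i Di).
exact: subspace0.
Qed.

(** Linearity of the component map comes from uniqueness of decompositions. *)
Lemma direct_sum_projection j : D j -> (forall i, is_subspace (W i)) ->
  exists p : V -> V, [/\ linear p, forall v, W j (p v),
    forall v, W j v -> p v = v & forall i v, D i -> i != j -> W i v -> p v = 0].
Proof.
move=> Dj sW; have /boolp.choice[u uP] := dsum.
have uu v w : [/\ forall i, D i -> W i (w i), forall i, ~ D i -> w i = 0,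
    finite_set [set i | w i <> 0] & \sum_(i \in D) w i = v] -> u v = w.
  by move=> wP; apply: (uP v).2.
have single i v : D i -> W i v -> u v = fun k => if k == i then v else 0.
  move=> Di Wv; apply: uu.
  have supp : [set k | (if k == i then v else 0) <> 0] `<=` [set` [fset i]%fset].
    by move=> k /=; rewrite inE; case: eqP.
  split=> [k Dk|k nDk||].
  - by case: eqP => [->//|_]; apply: subspace0.
  - by case: eqP nDk => // -> /(_ Di).
  - by apply: sub_finite_set supp _; apply: finite_fset.
  - rewrite (fsum_fset _ supp) ?big_seq_fset1 ?eqxx // => k nDk.
    by case: eqP nDk => // -> /(_ Di).
exists (fun v => u v j); split.
- move=> a v w /=; have [[Wv vD fv sv] _] := uP v; have [[Ww wD fw sw] _] := uP w.
  rewrite (@uu _ (fun i => a *: u v i + u w i)) //; split.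
  + by move=> i Di; apply: subspaceZD; [|apply: Wv|apply: Ww].
  + by move=> i nDi; rewrite vD ?wD // scaler0 addr0.
  + apply: sub_finite_set (_ : _ `<=` [set i | u v i <> 0] `|` [set i | u w i <> 0]) _.
      move=> i /= ui; apply: contrapT => /not_orP[/contrapT vi /contrapT wi].
      by apply: ui; rewrite vi wi scaler0 addr0.
    by rewrite finite_setU.
  + set X := fset_set ([set i | u v i <> 0] `|` [set i | u w i <> 0]).
    have XE : [set` X] = [set i | u v i <> 0] `|` [set i | u w i <> 0].
      by rewrite fset_setK // finite_setU.
    have Xv : [set i | u v i <> 0] `<=` [set` X] by rewrite XE; apply: subsetUl.
    have Xw : [set i | u w i <> 0] `<=` [set` X] by rewrite XE; apply: subsetUr.
    rewrite (fsum_fset vD Xv) in sv; rewrite (fsum_fset wD Xw) in sw.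
    rewrite (fsum_fset (X := X)).
    * by rewrite big_split -scaler_sumr /= sv sw.
    * by move=> i nDi; rewrite vD ?wD // scaler0 addr0.
    * rewrite XE => i /= ui; apply: contrapT => /not_orP[/contrapT vi /contrapT wi].
      by apply: ui; rewrite vi wi scaler0 addr0.
- by move=> v; have [[Wv _ _ _] _] := uP v; apply: Wv.
- by move=> v Wv; rewrite (single j) ?eqxx.
- by move=> i v Di ij Wv; rewrite (single i) // eq_sym (negPf ij).
Qed.

End DirectSum.

Section Weights.
Variables (F : fieldType) (L : lieAlgType F) (T : set L).
Implicit Types (alpha beta : T -> F).

(** Forms in the dual of T are functions on the type of elements of T, so a
    vector t of T has to be repackaged to be fed to a weight. *)
Definition elt t (Tt : T t) : T := exist _ t (mem_set Tt).

Lemma weightE alpha v t (Tt : T t) :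
  weight_space alpha v -> lie t v = alpha (elt Tt) *: v.
Proof. by move=> /(_ (elt Tt)). Qed.

Lemma weightNE alpha v t (Tt : T t) :
  weight_space (- alpha) v -> lie t v = - (alpha (elt Tt) *: v).
Proof. by move/(weightE Tt) ->; apply: scaleNr. Qed.

Lemma subspace_weight alpha : is_subspace (weight_space alpha).
Proof.
apply/is_subspaceP; split=> [h|a u v wu wv h]; first by rewrite linear0 scaler0.
by rewrite linearP /= wu wv scalerDr !scalerA mulrC.
Qed.

Lemma weight_lie alpha beta x y : weight_space alpha x -> weight_space beta y ->
  weight_space (alpha + beta) (lie x y).
Proof.
move=> wx wy h; rewrite lie_der wx wy linearZ /= lieC linearZ /= -scalerN -lieC.
by rewrite -scalerDl.
Qed.

Lemma weight_dual alpha v : weight_space alpha v -> v != 0 -> dual_space alpha.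
Proof.
move=> wv v0 a s u w sE; apply/eqP; rewrite -subr_eq0.
have : lie (\val w) v = (a * alpha s + alpha u) *: v.
  by rewrite sE lieZDl !wv scalerA -scalerDl.
by rewrite wv => /eqP; rewrite -subr_eq0 -scalerBl scaler_eq0 (negPf v0) orbF.
Qed.

Hypothesis dsum : is_direct_sum (@dual_space F L T) (@weight_space F L T).

Lemma weight_ind (P : set L) : is_subspace P ->
  (forall alpha v, weight_space alpha v -> v != 0 -> P v) -> forall v, P v.
Proof.
move=> sP wP; apply: (direct_sum_ind dsum sP) => alpha v _ wv.
by have [->|v0] := eqVneq v 0; [apply: subspace0 | apply: wP v0].
Qed.

(** [s, t] acts as 0 on weight vectors, since there ad s and ad t are scalars;
    so it is central. *)
Lemma toral_abelian s t : @lie_simple F L -> T s -> T t -> lie s t = 0.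
Proof.
move=> simpleL Ts Tt; apply: center_eq0 => //.
apply: (weight_ind (P := [set z | lie (lie s t) z = 0])) => [|alpha v wv _].
  by case: (commutant_subalgebra (lie s t)).
rewrite /= lie_lie (weightE Ts wv) (weightE Tt wv) [lie s _]linearZ [lie t _]linearZ /=.
by rewrite (weightE Ts wv) (weightE Tt wv) !scalerA mulrC subrr.
Qed.

(** The projections p onto weight -alpha and q onto weight 0 satisfy
    q [x, z] = [x, p z], as one sees on weight vectors z; then take y' = p y. *)
Lemma weight_component alpha x y :
    dual_space alpha -> weight_space alpha x -> weight_space (0 : T -> F) (lie x y) ->
  exists2 y', weight_space (- alpha) y' & lie x y' = lie x y.
Proof.
move=> da wx w0.
have dN : dual_space (- alpha).
  move=> a u v w /da; rewrite /GRing.opp /= => ->.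
  by rewrite opprD mulrN.
have d0 : dual_space (0 : T -> F) by move=> a u v w _; rewrite mulr0 addr0.
have sW := subspace_weight.
have [p [pL pW pid p0]] := direct_sum_projection dsum dN sW.
have [q [qL qW qid q0]] := direct_sum_projection dsum d0 sW.
have lz (f : L -> L) : linear f -> f 0 = 0.
  by move=> fL; have := fL 1 0 0; rewrite !scale1r addr0 -[LHS]addr0 => /addrI.
have qlie z : q (lie x z) = lie x (p z).
  move: z; apply: (weight_ind (P := [set z | q (lie x z) = lie x (p z)])).
    apply/is_subspaceP; split=> [|a u v /= qu qv].
      by rewrite /= (lz p) // linear0 lz.
    by rewrite linearP qL pL linearP /= qu qv.
  move=> beta z wz z0 /=; have wxz := weight_lie wx wz.
  have db := weight_dual wz z0.
  have [bE|nb] := eqVneq beta (- alpha).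
    by rewrite bE in wz wxz; rewrite subrr in wxz; rewrite pid // qid.
  rewrite (p0 beta) // linear0.
  have [->|xz0] := eqVneq (lie x z) 0; first exact: lz.
  apply: (q0 (alpha + beta)) => //; first exact: weight_dual xz0.
  by rewrite addrC addr_eq0.
by exists (p y); rewrite // -qlie qid.
Qed.

End Weights.

(** * Coroot pairs for a toral subalgebra containing H *)

Section Maximality.
Variables (F : fieldType) (charF0 : [pchar F] =i pred0) (L : lieAlgType F).
Variables (H T : set L).
Hypotheses (admH : admissible H) (simpleL : @lie_simple F L).
Hypotheses (lfL : @locally_finite F L) (torT : toral T) (HT : H `<=` T).

Let two0 : 2 != 0 :> F.
Proof. by rewrite ((pcharf0P F).1 charF0). Qed.

Let dsumT : is_direct_sum (@dual_space F L T) (@weight_space F L T).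
Proof. by case: torT. Qed.

Let sH : is_subspace H.
Proof. by case: admH => -[[sH _] _ _]. Qed.

Definition coroot_pair x y := exists alpha : T -> F,
  [/\ weight_space alpha x, weight_space (- alpha) y, H (lie x y),
      sl2_triple x (lie x y) y & x != 0].

(** The restriction beta of alpha to H is a root since x does not commute with
    H; the partner of x supplied by admissibility is replaced by its component
    of T-weight -alpha, which leaves the bracket with x unchanged. *)
Lemma coroot_pair_exists alpha x : @weight_space F L T alpha x ->
  (exists2 h, H h & lie h x != 0) -> exists y, coroot_pair x y.
Proof.
move=> wx [h0 Hh0 hx0].
have x0 : x != 0 by apply: contraNneq hx0 => ->; rewrite linear0.
pose beta (h : H) := alpha (elt (HT (set_valP h))).
have wbx : weight_space beta x by move=> h; rewrite (weightE (HT (set_valP h)) wx).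
have rb : root_system H beta.
  split; first exact: weight_dual wbx x0.
    by move=> b0; move: hx0; rewrite (weightE Hh0 wbx) b0 scale0r eqxx.
  by move=> w0; move: wbx; rewrite w0 /= => xE; rewrite xE eqxx in x0.
case: admH => _ _ /(_ _ rb x wbx)[|y [_ Hxy sl2]]; first exact/eqP.
have w0h : weight_space (0 : T -> F) (lie x y).
  by move=> t; rewrite scale0r (toral_abelian dsumT) //; [apply: set_valP|apply: HT].
have [y' wy' xy'] := weight_component dsumT (weight_dual wx x0) wx w0h.
exists y', alpha; rewrite xy'; split=> //.
case: sl2 => hx _ _; split=> //.
rewrite (weightE (HT Hxy) wy'); congr (_ *: _).
congr (- _); apply/eqP; rewrite -subr_eq0.
move/eqP: hx; rewrite (weightE (HT Hxy) wx) -subr_eq0 -scalerBl scaler_eq0.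
by rewrite (negPf x0) orbF.
Qed.

(** The generated subalgebra I is stable under every weight vector x, hence an
    ideal. If x does not commute with H it is one of the generators. Otherwise
    ad x preserves the generators up to 0: for a generator y with coroot h,
    [h, [x, y]] = 2 [x, y], so [x, y] is 0 or a weight vector not commuting with
    H. And I is not 0, for otherwise all weight vectors would commute with H
    and H would be central. *)
Lemma coroot_pairs_generate :
  lie_generated [set x | exists y, coroot_pair x y] = setT.
Proof.
set S := [set x | _]; have [gS gM] := lie_generated_subalgebra S.
have Sg : S `<=` lie_generated S by apply: sub_lie_generated.
have SP alpha x : @weight_space F L T alpha x ->
    S x \/ (forall h, H h -> lie h x = 0).
  move=> wx; case: (pselect (exists2 h, H h & lie h x != 0)) => [hx|nhx].
    by left; apply: coroot_pair_exists wx hx.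
  by right=> h Hh; apply/eqP/negP => hx; apply: nhx; exists h => //; apply/negP.
have id : lie_ideal (lie_generated S).
  split=> // x y Sy; move: x y Sy.
  apply: (weight_ind dsumT (P := [set x | forall y, lie_generated S y ->
      lie_generated S (lie x y)])).
    by case: (stabilizer_subalgebra gS).
  move=> alpha x wx _ y Sy; case: (SP _ _ wx) => [/Sg Sx|hx]; first exact: gM.
  suff : [set y | lie_generated S y /\ lie_generated S (lie x y)] y by case.
  move: y Sy; apply: lie_generated_min => [|y Sy].
    split=> [|u v [Su Sxu] [Sv Sxv]].
      apply/is_subspaceP; split; first by rewrite /= linear0; split; exact: (subspace0 gS).
      move=> a u v [Su Sxu] [Sv Sxv]; rewrite /= linearP /=.
      by split; exact: (subspaceZD _ gS).
    split; first exact: gM.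
    by rewrite lie_der; apply: (subspaceD gS); apply: gM.
  split; first exact: Sg.
  have [z [beta [wy wz Hyz [hy _ _] y0]]] := Sy.
  have hxy : lie (lie y z) (lie x y) = 2 *: lie x y.
    by rewrite lie_der hx // hy linearZ /= lieC linear0 oppr0 add0r.
  have [xy0|xy0] := eqVneq (lie x y) 0; first by rewrite xy0; exact: (subspace0 gS).
  case: (SP _ _ (weight_lie wx wy)) => [/Sg //|/(_ _ Hyz)/eqP].
  by rewrite hxy scaler_eq0 (negPf two0) (negPf xy0).
case: simpleL => _ /(_ _ id)[S0|//].
have noS x : ~ S x.
  move=> Sx; have [y [_ [_ _ _ _ /eqP x0]]] := Sx; apply: x0.
  by have := Sg _ Sx; rewrite S0.
case: admH => -[_ H0 _] _ _; exfalso; apply: H0.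
apply/seteqP; split=> [h Hh|_ ->]; last exact: (subspace0 sH).
apply: (center_eq0 simpleL).
apply: (weight_ind dsumT (P := [set z | lie h z = 0])) => [|alpha v wv _].
  by case: (commutant_subalgebra h).
by case: (SP _ _ wv) => [/noS//|]; apply.
Qed.

Definition pair_members (s : seq (L * L)) : set L :=
  [set z | exists2 p, p \in s & z = p.1 \/ z = p.2].

Definition coroot_pairs (s : seq (L * L)) := forall p, p \in s -> coroot_pair p.1 p.2.

Lemma finite_pair_members s : finite_set (pair_members s).
Proof.
apply: (sub_finite_set (B := [set` unzip1 s ++ unzip2 s])); last exact: finite_seq.
move=> z [p ps [->|->]] /=; rewrite mem_cat; first by rewrite map_f.
by rewrite orbC map_f.
Qed.

Lemma coroot_pairs_cover t :
  exists2 s, coroot_pairs s & lie_generated (pair_members s) t.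
Proof.
have : lie_generated [set x | exists y, coroot_pair x y] t.
  by rewrite coroot_pairs_generate.
move: t; apply: lie_generated_min => [|x [y xy]]; last first.
  exists [:: (x, y)] => [p|]; first by rewrite inE => /eqP ->.
  by apply: sub_lie_generated; exists (x, y); rewrite ?inE //; left.
have cat s1 s2 x y : lie_generated (pair_members s1) x ->
    lie_generated (pair_members s2) y ->
    lie_generated (pair_members (s1 ++ s2)) x /\
    lie_generated (pair_members (s1 ++ s2)) y.
  move=> g1 g2; split; [move: g1|move: g2]; apply: lie_generatedS => z [p ps pz];
    by exists p; rewrite // mem_cat ps ?orbT.
have catP s1 s2 : coroot_pairs s1 -> coroot_pairs s2 -> coroot_pairs (s1 ++ s2).
  by move=> c1 c2 p; rewrite mem_cat => /orP[/c1|/c2].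
split=> [|x y [s1 c1 g1] [s2 c2 g2]].
  apply/is_subspaceP; split=> [|a u v [s1 c1 g1] [s2 c2 g2]].
    by exists [::] => //; exact: (subspace0 (lie_generated_subalgebra _).1).
  have [g1' g2'] := cat _ _ _ _ g1 g2; exists (s1 ++ s2); first exact: catP.
  exact: (subspaceZD _ (lie_generated_subalgebra _).1).
have [g1' g2'] := cat _ _ _ _ g1 g2; exists (s1 ++ s2); first exact: catP.
exact: (lie_generated_subalgebra _).2.
Qed.

(** * Toral elements in the algebra generated by finitely many coroot pairs *)

Section FinitelyManyPairs.
Variables (s : seq (L * L)) (sP : coroot_pairs s).
Let A := pair_members s.
Let g := lie_generated A.

Let gS : is_subspace g. Proof. by case: (lie_generated_subalgebra A). Qed.

Let gM x y : g x -> g y -> g (lie x y).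
Proof. by case: (lie_generated_subalgebra A) => _; apply. Qed.

Let gA : A `<=` g. Proof. exact: sub_lie_generated. Qed.

(** On a T-weight vector v with [c, v] = mu v, mu <> 0, consider the
    mu-eigenspace E of ad c in the finite dimensional algebra generated by g and
    v. It is g-stable, so every element of g has trace 0 on E because the
    generators x and y are multiples of [h, x] and [h, y]; but c has trace
    mu * dim E. *)
Lemma toral_center_eq0 c : T c -> g c -> (forall a, A a -> lie c a = 0) -> c = 0.
Proof.
move=> Tc gc cA.
have cg a : g a -> lie c a = 0.
  by move: a; apply: lie_generated_min => //; apply: commutant_subalgebra.
apply: (center_eq0 simpleL).
apply: (weight_ind dsumT (P := [set z | lie c z = 0])) => [|alpha v wv v0 /=].
  by case: (commutant_subalgebra c).
have cv := weightE Tc wv; set mu := alpha _ in cv.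
have [mu0|mu0] := eqVneq mu 0; first by rewrite cv mu0 scale0r.
pose W := lie_generated (A `|` [set v]).
have [WS WM] := lie_generated_subalgebra (A `|` [set v]).
have fW : fin_dim W.
  by apply: lfL; rewrite finite_setU; split; [apply: finite_pair_members|].
have gW : g `<=` W by apply: lie_generatedS; apply: subsetUl.
pose E := [set z | W z /\ lie c z = mu *: z].
have Ev : E v by split=> //; apply: sub_lie_generated; right.
have [n [e [fe Ee Espan]]] := basis_exists (W := W) (S := E) fW (fun z => @proj1 _ _).
have eE : E `<=` spanned e.
  by apply: subset_trans Espan; apply: sub_gen_smallest.
have sg a : g a -> ad_stable e a.
  move=> ga i; apply: eE; have [We ce] := Ee i; split; first by apply: WM => //; apply: gW.
  by rewrite lie_der cg // ce linearZ /= lieC linear0 oppr0 add0r.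
have tr0 : forall a, g a -> \tr (ad_mx e a) = 0.
  apply: (trace_generated fe sg) => a [p ps ap].
  have [_ [_ _ _ [hx hy _] _]] := sP ps.
  have gx : g p.1 by apply: gA; exists p => //; left.
  have gy : g p.2 by apply: gA; exists p => //; right.
  have gh := gM gx gy.
  have trZ k b : k != 0 -> g b -> lie (lie p.1 p.2) b = k *: b -> \tr (ad_mx e b) = 0.
    move=> k0 gb hb; have := trace_lie fe (sg _ gh) (sg _ gb).
    rewrite hb ad_mxZ //; last exact: sg.
    by rewrite mxtraceZ => /eqP; rewrite mulf_eq0 (negPf k0) => /eqP.
  by case: ap => ->; [apply: (trZ 2)|apply: (trZ (-2))]; rewrite ?oppr_eq0.
have cE : ad_mx e c = mu%:M.
  apply: ad_mxE => // i; have [_ ->] := Ee i.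
  by rewrite -scalemx1 linearZ /= row1 linearZ /= lincomb_delta.
have := tr0 c gc; rewrite cE mxtrace_scalar -mulr_natr => /eqP.
rewrite mulf_eq0 (negPf mu0) ((pcharf0P F).1 charF0) /= => /eqP n0.
have [d _ dv] := eE _ Ev; rewrite -dv in v0.
case/eqP: v0; rewrite /lincomb big1 // => i.
by have := leq_ltn_trans (leq0n i) (ltn_ord i); rewrite [in ltnRHS]n0.
Qed.

(** The span of the weight vectors of g is a subalgebra containing the
    generators, so it is g, and a basis can be extracted from them. *)
Lemma weight_basis_exists : exists n (e : 'I_n -> L),
  [/\ lin_free e, forall i, exists alpha : T -> F, weight_space alpha (e i)
    & g `<=` spanned e /\ forall a, g a -> ad_stable e a].
Proof.
pose S := [set z | g z /\ exists alpha : T -> F, weight_space alpha z].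
have fg : fin_dim g by apply: lfL; apply: finite_pair_members.
have [n [e [fe Se Sspan]]] := basis_exists (W := g) (S := S) fg (fun z => @proj1 _ _).
have ge : g `<=` spanned e.
  apply: subset_trans Sspan; apply: lie_generated_min => [|z Az].
    apply: lspan_subalgebra => x y [gx [alpha wx]] [gy [beta wy]].
    by split; [apply: gM | exists (alpha + beta); apply: weight_lie].
  apply: sub_gen_smallest; split; first exact: gA.
  have [p ps zp] := Az; have [alpha [wx wy _ _ _]] := sP ps.
  by case: zp => ->; [exists alpha|exists (- alpha)].
exists n, e; split=> // [i|]; first exact: (Se i).2.
by split=> // a ga i; apply: ge; apply: gM => //; exact: (Se i).1.
Qed.

(** The Gram system of the h i for the trace form is solved for the
    coefficients of t; every element of T in g that is orthogonal to all the h i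
    vanishes, which gives both solvability and the equality with t. *)
Lemma toral_generated_in t : T t -> g t -> H t.
Proof.
move=> Tt gt; have [n [e [fe we [ge sg]]]] := weight_basis_exists.
pose m := size s; pose p (i : 'I_m) := tnth (in_tuple s) i.
have ps i : p i \in s by apply: mem_tnth.
pose h i := lie (p i).1 (p i).2.
have gx i : g (p i).1 by apply: gA; exists (p i) => //; left.
have gy i : g (p i).2 by apply: gA; exists (p i) => //; right.
have gh i : g (h i) by apply: gM.
have Hh i : H (h i) by have [? []] := sP (ps i).
have sgh i := sg _ (gh i).
have gl c : g (lincomb h c) by apply: (subspace_sum _ gS) => i _; exact: (subspaceZ _ gS).
have Hl c : H (lincomb h c) by apply: (subspace_sum _ sH) => i _; exact: (subspaceZ _ sH).
have orth i u : T u -> g u -> trace_form e (h i) u = 0 ->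
    lie u (p i).1 = 0 /\ lie u (p i).2 = 0.
  move=> Tu gu; have [alpha [wx wy _ sl2 x0]] := sP (ps i).
  have tr_coroot v (Tv : T v) : g v -> trace_form e (h i) v =
      alpha (elt Tv) * trace_form e (p i).1 (p i).2.
    move=> gv; rewrite (trace_form_lie fe (sg _ (gx i)) (sg _ (gy i)) (sg _ gv)).
    rewrite lieC (weightNE Tv wy) opprK.
    by rewrite /trace_form (ad_mxZ fe _ (sg _ (gy i))) -scalemxAr mxtraceZ.
  have tr0 : trace_form e (p i).1 (p i).2 != 0.
    have := trace_form_coroot_neq0 charF0 sl2 (sg _ (gx i)) (sg _ (gy i)) fe
      (ge _ (gx i)) x0.
    rewrite (tr_coroot _ (HT (Hh i))) // mulf_eq0 => H0.
    suff /H0 : forall j, exists mu, lie (h i) (e j) = mu *: e j by case/norP.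
    by move=> j; have [beta wj] := we j; exists (beta (elt (HT (Hh i)))); apply: weightE.
  rewrite tr_coroot // => /eqP; rewrite mulf_eq0 (negPf tr0) orbF => /eqP au.
  by rewrite (weightE Tu wx) (weightNE Tu wy) au !scale0r oppr0.
have central u : T u -> g u -> (forall i, trace_form e (h i) u = 0) -> u = 0.
  move=> Tu gu u0; apply: toral_center_eq0 => // a [q qs qa].
  have [i qE] : exists i, q = p i by case/(tnthP (in_tuple s)): qs => i ->; exists i.
  by have [ux uy] := orth i u Tu gu (u0 i); case: qa => ->; rewrite qE.
have tr_comb a c : trace_form e a (lincomb h c) = \sum_j c 0 j * trace_form e a (h j).
  rewrite /trace_form ad_mx_lincomb // mulmx_sumr raddf_sum /=.
  by apply: eq_bigr => j _; rewrite -scalemxAr mxtraceZ.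
pose G := \matrix_(i, j) trace_form e (h i) (h j).
pose b := \row_i trace_form e (h i) t.
suff /submxP[c bE] : (b <= G)%MS.
  suff /eqP : t - lincomb h c = 0 by rewrite subr_eq0 => /eqP ->.
  apply: central => [||i].
  - by apply: subspaceB => //; [case: torT => -[] | apply: HT].
  - exact: (subspaceB gS).
  suff tE : trace_form e (h i) t = trace_form e (h i) (lincomb h c).
    rewrite /trace_form (ad_mxB fe (sg _ gt) (sg _ (gl c))) mulmxBr raddfB /=.
    by apply/eqP; rewrite subr_eq0; apply/eqP.
  rewrite tr_comb; move/rowP/(_ i): bE; rewrite !mxE => ->.
  by apply: eq_bigr => j _; rewrite !mxE trace_formC.
(* Solvability: b must kill each column of the cokernel of the Gram matrix G,
   and such a column gives a combination of the h i orthogonal to all of them. *)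
rewrite submxE; apply/eqP/rowP => j; rewrite mxE [RHS]mxE.
pose c := \row_i cokermx G i j.
have c0 : lincomb h c = 0.
  apply: central => // [|i]; first exact: HT.
  rewrite tr_comb; have /matrixP/(_ i j) := mulmx_coker G.
  by rewrite !mxE => GK; rewrite -[RHS]GK; apply: eq_bigr => k _; rewrite !mxE mulrC.
have : trace_form e t (lincomb h c) = 0.
  by rewrite c0 /trace_form ad_mx0 // mulmx0 mxtrace0.
rewrite tr_comb => tr_t; rewrite -[RHS]tr_t; apply: eq_bigr => k _.
by rewrite !mxE mulrC trace_formC.
Qed.

End FinitelyManyPairs.
End Maximality.

Theorem proposition2p35 (F : fieldType) (charF0 : [pchar F] =i pred0)
    (L : lieAlgType F) (H : set L)
    (admH : admissible H)
    (simpleL : lie_simple L)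
    (lfL : locally_finite L)
    (fdW : forall alpha : H -> F, root_system H alpha -> fin_dim (weight_space alpha)) :
  maximal_toral H.
Proof.
split=> [|T torT HT]; first by case: admH.
apply/seteqP; split=> // t Tt.
have [s sP gt] := coroot_pairs_cover charF0 admH simpleL torT HT t.
exact: toral_generated_in sP _ Tt gt.
Qed.
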